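(* Let $\mathcal X$ and $\mathcal Y$ be Banach spaces, and let $U\in\mathcal B(\mathcal X)$ and $V\in\mathcal B(\mathcal Y)$ be inessential operators. Then the following three statements are equivalent: (1) $U$ and $V$ are equivalent after extension (EAE); (2) $U$ and $V$ are equivalent after one-sided extension (EAOE); (3) $U$ and $V$ are Schur coupled (SC). Moreover, in this case $U$ and $V$ are EAE and EAOE with extensions on finite dimensional Banach spaces, i.e., the extension spaces $\mathcal X_0$ and $\mathcal Y_0$ in the definitions of EAE and EAOE can be chosen finite dimensional.
   Context: $\mathcal B(\mathcal V,\mathcal W)$ denotes the bounded linear operators from the Banach space $\mathcal V$ to the Banach space $\mathcal W$, and $\mathcal B(\mathcal V)=\mathcal B(\mathcal V,\mathcal V)$. ''Operator'' means bounded linear operator, and ''invertible'' means having a bounded inverse. Inessential: $T\in\mathcal B(\mathcal V,\mathcal W)$ is inessential if $I_{\mathcal V}-ST$ is Fredholm for every $S\in\mathcal B(\mathcal W,\mathcal V)$ (equivalently, $I_{\mathcal W}-TS$ is Fredholm for every $S\in\mathcal B(\mathcal W,\mathcal V)$). EAE: $U\in\mathcal B(\mathcal X)$ and $V\in\mathcal B(\mathcal Y)$ are equivalent after extension if there exist Banach spaces $\mathcal X_0,\mathcal Y_0$ and invertible operators $E\in\mathcal B(\mathcal Y\oplus\mathcal Y_0,\mathcal X\oplus\mathcal X_0)$ and $F\in\mathcal B(\mathcal X\oplus\mathcal X_0,\mathcal Y\oplus\mathcal Y_0)$ such that $\begin{bmatrix}U&0\\0&I_{\mathcal X_0}\end{bmatrix}=E\begin{bmatrix}V&0\\0&I_{\mathcal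 Y_0}\end{bmatrix}F$. EAOE: $U$ and $V$ are equivalent after one-sided extension if this holds with $\mathcal X_0=\{0\}$ or $\mathcal Y_0=\{0\}$. SC: $U$ and $V$ are Schur coupled if there exists $M=\begin{bmatrix}A&B\\C&D\end{bmatrix}\in\mathcal B(\mathcal X\oplus\mathcal Y)$ with $A\in\mathcal B(\mathcal X)$ and $D\in\mathcal B(\mathcal Y)$ invertible, $U=A-BD^{-1}C$ and $V=D-CA^{-1}B$. *)

(* Defs.v *)
From mathcomp Require Import all_boot all_order all_algebra complex.
From mathcomp Require Import all_classical all_reals all_analysis.

Set Implicit Arguments.
Unset Strict Implicit.
Unset Printing Implicit Defensive.

Import Order.TTheory GRing.Theory Num.Theory numFieldNormedType.Exports.

Local Open Scope classical_set_scope.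
Local Open Scope ring_scope.

Inductive scalars := RealScalars | ComplexScalars.

Definition scalar_field (R : realType) (s : scalars) : numFieldType :=
  match s with RealScalars => R | ComplexScalars => R[i] end.

Section Operators.
Context {K : numFieldType}.
Implicit Types V W : normedModType K.

Definition bounded_operator V W (T : V -> W) : Prop :=
  linear T /\ bounded_near T (nbhs (0 : V)).

Definition inverse_operator V W (T : V -> W) (T' : W -> V) : Prop :=
  [/\ bounded_operator T', cancel T T' & cancel T' T].

Definition invertible_operator V W (T : V -> W) : Prop :=
  bounded_operator T /\ exists T' : W -> V, inverse_operator T T'.

Definition lin_span V n (e : 'I_n -> V) : set V :=
  [set v | exists c : 'I_n -> K, v = \sum_(i < n) c i *: e i].

Definition finite_dim V (A : set V) : Prop :=
  exists n (e : 'I_n -> V), A = lin_span e.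

Definition finite_codim V (A : set V) : Prop :=
  exists n (e : 'I_n -> V), forall v, exists2 w, A w & lin_span e (v - w).

(* Closedness of the range is not required: between Banach spaces it follows
   from the finite codimension. *)
Definition Fredholm V W (T : V -> W) : Prop :=
  finite_dim [set v | T v = 0] /\ finite_codim (range T).

Definition inessential V W (T : V -> W) : Prop :=
  forall S : W -> V, bounded_operator S -> Fredholm (fun v => v - S (T v)).

(* The operator with block matrix [A B; C D]; the sum V1 (+) V2 is the library's
   product, whose norm is the maximum of the two norms. *)
Definition block_op V1 V2 W1 W2 (A : V1 -> W1) (B : V2 -> W1)
    (C : V1 -> W2) (D : V2 -> W2) (p : V1 * V2) : W1 * W2 :=
  (A p.1 + B p.2, C p.1 + D p.2).

(* U (+) I = E (V (+) I) F, for the given extension spaces X0 and Y0. *)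
Definition equivalent_ext (X Y : completeNormedModType K)
    (U : X -> X) (V : Y -> Y) (X0 Y0 : completeNormedModType K) : Prop :=
  exists (E : Y * Y0 -> X * X0) (F : X * X0 -> Y * Y0),
    [/\ invertible_operator E, invertible_operator F &
        block_op U (fun=> 0) (fun=> 0) (@id X0) =
        E \o block_op V (fun=> 0) (fun=> 0) (@id Y0) \o F].

Definition trivial_space V : Prop := [set: V] = [set 0].

Definition finite_dim_space V : Prop := finite_dim [set: V].

Definition EAE (X Y : completeNormedModType K) (U : X -> X) (V : Y -> Y) :=
  exists X0 Y0 : completeNormedModType K, equivalent_ext U V X0 Y0.

Definition EAOE (X Y : completeNormedModType K) (U : X -> X) (V : Y -> Y) :=
  exists X0 Y0 : completeNormedModType K,
    (trivial_space X0 \/ trivial_space Y0) /\ equivalent_ext U V X0 Y0.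

Definition EAE_finite_dim (X Y : completeNormedModType K)
    (U : X -> X) (V : Y -> Y) :=
  exists X0 Y0 : completeNormedModType K,
    [/\ finite_dim_space X0, finite_dim_space Y0 & equivalent_ext U V X0 Y0].

Definition EAOE_finite_dim (X Y : completeNormedModType K)
    (U : X -> X) (V : Y -> Y) :=
  exists X0 Y0 : completeNormedModType K,
    [/\ finite_dim_space X0, finite_dim_space Y0,
        trivial_space X0 \/ trivial_space Y0 & equivalent_ext U V X0 Y0].

Definition Schur_coupled (X Y : completeNormedModType K)
    (U : X -> X) (V : Y -> Y) :=
  exists (A : X -> X) (B : Y -> X) (C : X -> Y) (D : Y -> Y),
    [/\ bounded_operator B, bounded_operator C,
        bounded_operator (block_op A B C D),
        invertible_operator A & invertible_operator D] /\
    exists (A' : X -> X) (D' : Y -> Y),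
      [/\ inverse_operator A A', inverse_operator D D',
          U = (fun x => A x - B (D' (C x))) &
          V = (fun y => D y - C (A' (B y)))].

End Operators.

(* Main.v *)
(* From an equivalence after extension one reads off bounded operators
   J, Q : Y -> X and G, S : X -> Y that are mutually inverse homotopy
   equivalences between the two-term complexes V and U: UJ = QV, and 1 - JG,
   1 - GJ are TU, HV with bounded T and H.  As U and V are inessential, J has a
   finite-dimensional kernel and a range of finite codimension.  After adding
   identities on K^a to U and on K^b to V, with a = 0 or b = 0, the two
   dimensions agree.  By Hahn-Banach a finite rank operator T0 can be chosen so
   that J + T0 V is bijective, hence invertible by the bounded inverse theorem;
   Q + U T0 is then automatically invertible, and
   U (J + T0 V) = (Q + U T0) V is an equivalence with one-sided
   finite-dimensional extension.  The remaining implications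
   EAOE -> SC -> EAE are explicit factorizations.  Complex scalars are reduced
   to real ones by restriction of scalars. *)

Require Import Defs.
From HB Require Import structures.
From mathcomp Require Import all_boot all_order all_algebra complex ring lra.
From mathcomp Require Import all_classical all_reals all_analysis.

Set Implicit Arguments.
Unset Strict Implicit.
Unset Printing Implicit Defensive.

Import Order.TTheory GRing.Theory Num.Theory numFieldNormedType.Exports.

Local Open Scope classical_set_scope.
Local Open Scope ring_scope.

(** * Bounded operators *)

(** [bounded_operator] carries linearity as a proposition; bundling it gives access to the general
    lemmas on linear maps. *)
Definition pack_linear (K : pzRingType) (V W : lmodType K) (T : V -> W)
    (lT : linear T) : {linear V -> W} :=
  HB.pack T (GRing.isLinear.Build _ _ _ _ _ lT).

Section BoundedOperators.
Context {K : numFieldType}.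
Implicit Types V W Z : normedModType K.

Lemma bounded_operatorP V W (T : V -> W) :
  bounded_operator T <-> linear T /\ continuous T.
Proof.
split=> -[lT cT]; split=> //.
  exact: (@bounded_linear_continuous _ _ _ (pack_linear lT)).
exact: (@continuous_linear_bounded _ _ _ 0 (pack_linear lT) (cT 0)).
Qed.

Lemma bounded_operator_normP V W (T : V -> W) :
  bounded_operator T <->
  linear T /\ exists2 C, 0 < C & forall x, `|T x| <= C * `|x|.
Proof.
split=> -[lT bT]; split=> //.
  have /(@linear_boundedP _ _ _ (pack_linear lT))/pinfty_ex_gt0[C C0 CT] := bT.
  by exists C.
have [C C0 CT] := bT.
apply/ex_bound; exists C; apply/nbhs_norm0P; exists 1 => //= x x1.
by apply: le_trans (CT x) _; rewrite ler_piMr ?ltW.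
Qed.

Section Theory.
Context V W (T : V -> W) (bT : bounded_operator T).
Let f := pack_linear bT.1.

Lemma bopD x y : T (x + y) = T x + T y. Proof. exact: (linearD f). Qed.
Lemma bopB x y : T (x - y) = T x - T y. Proof. exact: (linearB f). Qed.
Lemma bopN x : T (- x) = - T x. Proof. exact: (linearN f). Qed.
Lemma bopZ a x : T (a *: x) = a *: T x. Proof. exact: (linearZ_LR f). Qed.
Lemma bop0 : T 0 = 0. Proof. exact: (linear0 f). Qed.

End Theory.

Lemma bop_id V : bounded_operator (@id V).
Proof. by apply/bounded_operatorP; split=> // x. Qed.

Lemma bop_zero V W : bounded_operator (fun _ : V => 0 : W).
Proof.
apply/bounded_operatorP; split; last exact: cst_continuous.
by move=> a x y; rewrite scaler0 addr0.
Qed.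

Lemma bop_comp V W Z (S : W -> Z) (T : V -> W) :
  bounded_operator S -> bounded_operator T ->
  bounded_operator (fun x => S (T x)).
Proof.
move=> /bounded_operatorP[lS cS] /bounded_operatorP[lT cT].
apply/bounded_operatorP; split=> [a x y|x]; first by rewrite lT lS.
exact: continuous_comp (cT x) (cS _).
Qed.

Lemma bop_add V W (S T : V -> W) : bounded_operator S -> bounded_operator T ->
  bounded_operator (fun x => S x + T x).
Proof.
move=> /bounded_operatorP[lS cS] /bounded_operatorP[lT cT].
apply/bounded_operatorP; split=> [a x y|x]; last exact: cvgD (cS x) (cT x).
by rewrite lS lT scalerDr addrACA.
Qed.

Lemma bop_opp V W (T : V -> W) : bounded_operator T ->
  bounded_operator (fun x => - T x).
Proof.
move=> /bounded_operatorP[lT cT].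
apply/bounded_operatorP; split=> [a x y|x]; last exact: cvgN (cT x).
by rewrite lT opprD scalerN.
Qed.

Lemma bop_sub V W (S T : V -> W) : bounded_operator S -> bounded_operator T ->
  bounded_operator (fun x => S x - T x).
Proof. by move=> bS /bop_opp; exact: bop_add. Qed.

Lemma bop_fst V W : bounded_operator (@fst V W).
Proof.
by apply/bounded_operatorP; split=> // x; exact: cvg_fst.
Qed.

Lemma bop_snd V W : bounded_operator (@snd V W).
Proof. by apply/bounded_operatorP; split=> // x; exact: cvg_snd. Qed.

Lemma bop_pair V W Z (S : V -> W) (T : V -> Z) :
  bounded_operator S -> bounded_operator T ->
  bounded_operator (fun x => (S x, T x)).
Proof.
move=> /bounded_operatorP[lS cS] /bounded_operatorP[lT cT].
apply/bounded_operatorP; split=> [a x y|x]; last exact: cvg_pair (cS x) (cT x).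
by rewrite lS lT.
Qed.

Lemma bop_inl V W : bounded_operator (fun x : V => (x, 0 : W)).
Proof. exact: bop_pair (bop_id V) (bop_zero V W). Qed.

Lemma bop_inr V W : bounded_operator (fun x : W => (0 : V, x)).
Proof. exact: bop_pair (bop_zero W V) (bop_id W). Qed.

Lemma bop_block V1 V2 W1 W2 (A : V1 -> W1) (B : V2 -> W1)
    (C : V1 -> W2) (D : V2 -> W2) :
  bounded_operator A -> bounded_operator B -> bounded_operator C ->
  bounded_operator D -> bounded_operator (block_op A B C D).
Proof.
move=> bA bB bC bD; apply: bop_pair; apply: bop_add;
by apply: bop_comp => //; (exact: bop_fst || exact: bop_snd).
Qed.

Lemma bop_sumr V W (I : finType) (F : I -> V -> W) :
  (forall i, bounded_operator (F i)) ->
  bounded_operator (fun x => \sum_i F i x).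
Proof.
move=> bF; rewrite -[X in bounded_operator X](_ : \sum_i F i = _).
  by apply: (big_ind (fun T => bounded_operator T));
    [exact: bop_zero|exact: bop_add|].
by apply/funext => x; rewrite fct_sumE.
Qed.

Lemma bop_scale V (T : V -> K^o) W (w : W) : bounded_operator T ->
  bounded_operator (fun x => T x *: w).
Proof.
move=> /bounded_operatorP[lT cT].
apply/bounded_operatorP; split=> [a x y|x].
  by rewrite lT scalerDl scalerA.
by apply: cvgZr_tmp; exact: cT.
Qed.

Lemma invertible_operatorI V W (T : V -> W) (T' : W -> V) :
  bounded_operator T -> bounded_operator T' -> cancel T T' -> cancel T' T ->
  invertible_operator T.
Proof. by move=> bT bT' TK T'K; split=> //; exists T'. Qed.

End BoundedOperators.

(** * One-sided extensions and Schur coupling *)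

Section Equivalences.
Context {K : numFieldType}.
Implicit Types X Y : completeNormedModType K.

Lemma equivalent_ext_sym X Y (U : X -> X) (V : Y -> Y)
    (X0 Y0 : completeNormedModType K) :
  equivalent_ext U V X0 Y0 -> equivalent_ext V U Y0 X0.
Proof.
move=> [E [F [[bE [E' [bE' EK E'K]]] [bF [F' [bF' FK F'K]]] eqUV]]].
exists E', F'; split.
- exact: invertible_operatorI bE' bE E'K EK.
- exact: invertible_operatorI bF' bF F'K FK.
- by apply/funext => y /=; rewrite eqUV /= F'K EK.
Qed.

Lemma Schur_coupled_sym X Y (U : X -> X) (V : Y -> Y) :
  Schur_coupled U V -> Schur_coupled V U.
Proof.
move=> [A [B [C [D [[bB bC _ iA iD] [A' [D' [AA' DD' eU eV]]]]]]]].
exists D, C, B, A; split; last by exists D', A'.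
by split=> //; apply: bop_block => //; [exact: iD.1|exact: iA.1].
Qed.

(* The factorizations [U 0; 0 D] = [1 -BD'; 0 1] M [1 0; -D'C 1] and
   M = [1 0; CA' 1] [A 0; 0 V] [1 A'B; 0 1], where M = [A B; C D], make
   U (+) 1 equivalent to V (+) 1. *)
Lemma Schur_coupled_EAE X Y (U : X -> X) (V : Y -> Y) :
  Schur_coupled U V -> EAE U V.
Proof.
move=> [A [B [C [D [[bB bC bM iA iD]
  [A' [D' [[bA' AK A'K] [bD' DK D'K] eU eV]]]]]]]].
have [bA bD] := (iA.1, iD.1).
pose F (p : X * Y) : Y * X :=
  (p.2 - D' (C p.1), A p.1 + B (p.2 - D' (C p.1))).
pose F' (q : Y * X) : X * Y :=
  (A' (q.2 - B q.1), q.1 + D' (C (A' (q.2 - B q.1)))).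
pose E (q : Y * X) : X * Y :=
  (q.2 - B (D' (q.1 + C (A' q.2))), D' (q.1 + C (A' q.2))).
pose E' (p : X * Y) : Y * X :=
  (D p.2 - C (A' (p.1 + B p.2)), p.1 + B p.2).
have b1 := @bop_fst K; have b2 := @bop_snd K.
exists Y, X, E, F; split.
- apply: (@invertible_operatorI _ _ _ _ E').
  + by apply: bop_pair; [apply: bop_sub => //|];
    do ?[apply: bop_comp => //|apply: bop_add => //].
  + by apply: bop_pair; [apply: bop_sub => //|];
    do ?[apply: bop_comp => //|apply: bop_add => //].
  + by move=> [y x]; rewrite /E /E' /= subrK D'K addrK.
  + by move=> [x y]; rewrite /E /E' /= subrK DK addrK.
- apply: (@invertible_operatorI _ _ _ _ F').
  + apply: bop_pair; [apply: bop_sub => //|apply: bop_add => //];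
    by do ?[apply: bop_comp => //|apply: bop_sub => //].
  + apply: bop_pair; [|apply: bop_add => //];
    by do ?[apply: bop_comp => //|apply: bop_sub => //].
  + by move=> [x y]; rewrite /F /F' /= addrK AK subrK.
  + by move=> [y x]; rewrite /F /F' /= addrK A'K subrK.
- apply/funext => -[x y]; rewrite /block_op /E /F /= !addr0 !add0r.
  rewrite eU eV /=; set z := y - D' (C x).
  have -> : D z - C (A' (B z)) + C (A' (A x + B z)) = D y.
    rewrite (bopD bA') AK (bopD bC) addrCA subrK.
    by rewrite /z (bopB bD) D'K addrC subrK.
  by rewrite DK /z (bopB bB) addrA addrAC addrK.
Qed.

(** When [Y0] is zero, identify [Y * Y0] with [Y]; then [D = E' F'] is invertible on [Y] with
    inverse [D' = F E]. Take [A = 1], [C] the restriction of [E'] to [X], and [B = (1 - U) F'_1]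
    with [F'_1] the [X]-component of [F']. Then [D' C x = F (x, 0)], whence [U = 1 - B D' C], while
    [V = E' (U (+) 1) F'] gives [V = D - C B]. *)
Lemma equivalent_ext_Schur_coupled X Y (U : X -> X) (V : Y -> Y)
    (X0 Y0 : completeNormedModType K) :
  bounded_operator U -> bounded_operator V ->
  trivial_space Y0 -> equivalent_ext U V X0 Y0 -> Schur_coupled U V.
Proof.
move=> bU bV Y00 [E [F [[bE [E' [bE' EK E'K]]] [bF [F' [bF' FK F'K]]] eUV]]].
have y00 (z : Y0) : z = 0 by have : [set: Y0] z by []; rewrite Y00.
have fstK (q : Y * Y0) : (q.1, 0) = q by case: q => y z; rewrite (y00 z).
have b1 := @bop_fst K; have b2 := @bop_snd K.
pose D y := (E' (F' (y, 0))).1; pose D' y := (F (E (y, 0))).1.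
pose C x := (E' (x, 0)).1; pose B y := (F' (y, 0)).1 - U (F' (y, 0)).1.
have bi := @bop_inl K; have bid := @bop_id K.
have bD : bounded_operator D.
  by apply: bop_comp => //; do 2!apply: bop_comp => //.
have bD' : bounded_operator D'.
  by apply: bop_comp => //; do 2!apply: bop_comp => //.
have bC : bounded_operator C by apply: bop_comp => //; apply: bop_comp => //.
have bB : bounded_operator B.
  apply: bop_sub; last apply: bop_comp => //;
  by apply: bop_comp => //; apply: bop_comp.
have DK : cancel D D' by move=> y; rewrite /D /D' fstK E'K F'K.
have D'K : cancel D' D by move=> y; rewrite /D /D' fstK FK EK.
exists id, B, C, D; split; first split=> //.
- exact: bop_block.
- by apply: (invertible_operatorI (bid X) (bid X)).
- exact: invertible_operatorI bD bD' DK D'K.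
- exists id, D'; split=> //.
    by apply/funext => x; rewrite /D' /C fstK E'K /B fstK FK /= subKr.
  apply/funext => y; rewrite /D /C /B -(bopB (b1 Y Y0)) -(bopB bE').
  have /(congr1 (fun f => (E' (f (F' (y, 0)))).1)) := eUV.
  rewrite /= F'K EK /block_op /= !addr0 !add0r => <-.
  congr ((E' _).1); case: (F' _) => x z /=.
  by congr pair; rewrite /= ?subKr ?subr0.
Qed.

Lemma EAOE_Schur_coupled X Y (U : X -> X) (V : Y -> Y) :
  bounded_operator U -> bounded_operator V ->
  EAOE U V -> Schur_coupled U V.
Proof.
move=> bU bV [X0 [Y0 [[X00|Y00] e]]].
  apply: Schur_coupled_sym.
  exact: equivalent_ext_Schur_coupled bV bU X00 (equivalent_ext_sym e).
exact: equivalent_ext_Schur_coupled bU bV Y00 e.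
Qed.

End Equivalences.

(** * Couplings *)

Section Coupling.
Context {K : numFieldType}.
Implicit Types X Y : normedModType K.

(* [J], [Q] and [G], [S] are mutually inverse homotopy equivalences between the
   two-term complexes [V] and [U], with homotopies [T] and [H]; equivalently,
   the operator matrices [U -Q; G H] and [T J; -S V] are mutually inverse. *)
Record coupling X Y (U : X -> X) (V : Y -> Y) (J Q : Y -> X) (G S : X -> Y)
    (T : X -> X) (H : Y -> Y) : Prop := Coupling {
  coupling_bJ : bounded_operator J;
  coupling_bQ : bounded_operator Q;
  coupling_bG : bounded_operator G;
  coupling_bS : bounded_operator S;
  coupling_bT : bounded_operator T;
  coupling_bH : bounded_operator H;
  coupling_UJ : forall y, U (J y) = Q (V y);
  coupling_SU : forall x, S (U x) = V (G x);
  coupling_JG : forall x, J (G x) + T (U x) = x;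
  coupling_GJ : forall y, G (J y) + H (V y) = y;
  coupling_QS : forall x, U (T x) + Q (S x) = x;
  coupling_SQ : forall y, S (Q y) + V (H y) = y;
  coupling_TQ : forall y, T (Q y) = J (H y) }.

(** [J], [Q], [G], [S] are the upper left corners of [F'], [E], [F], [E']. The relations
    [E' (U (+) 1) = (V (+) 1) F] and [(U (+) 1) F' = E (V (+) 1)] express the lower left corners of
    [F] and [F'] as those of [E'] and [E] times [U] and [V], so the remaining terms in the corners
    of [F' F = 1] and [F F' = 1] become [T U] and [H V]. *)
Lemma EAE_coupling (X Y : completeNormedModType K) (U : X -> X) (V : Y -> Y) :
  bounded_operator U -> bounded_operator V -> EAE U V ->
  exists (J Q : Y -> X) (G S : X -> Y) (T : X -> X) (H : Y -> Y),
    coupling U V J Q G S T H.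
Proof.
move=> bU bV [X0 [Y0 [E [F [[bE [E' [bE' EK E'K]]]
  [bF [F' [bF' FK F'K]]] eUV]]]]].
have eF p : E' (U p.1, p.2) = (V (F p).1, (F p).2).
  have /(congr1 (fun f => E' (f p))) := eUV.
  by rewrite /block_op /= !addr0 !add0r EK.
have eE q : (U (F' q).1, (F' q).2) = E (V q.1, q.2).
  have /(congr1 (fun f => f (F' q))) := eUV.
  by rewrite /block_op /= F'K !addr0 !add0r.
have sE (a : Y) (b : Y0) : E (a, b) = E (a, 0) + E (0, b).
  by rewrite -(bopD bE); congr E; congr pair; rewrite ?addr0 ?add0r.
have sE' (a : X) (b : X0) : E' (a, b) = E' (a, 0) + E' (0, b).
  by rewrite -(bopD bE'); congr E'; congr pair; rewrite ?addr0 ?add0r.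
have sF (a : X) (b : X0) : F (a, b) = F (a, 0) + F (0, b).
  by rewrite -(bopD bF); congr F; congr pair; rewrite ?addr0 ?add0r.
have sF' (a : Y) (b : Y0) : F' (a, b) = F' (a, 0) + F' (0, b).
  by rewrite -(bopD bF'); congr F'; congr pair; rewrite ?addr0 ?add0r.
have b1 := @bop_fst K; have b2 := @bop_snd K.
have il := @bop_inl K; have ir := @bop_inr K.
exists (fun y => (F' (y, 0)).1), (fun y => (E (y, 0)).1),
  (fun x => (F (x, 0)).1), (fun x => (E' (x, 0)).1),
  (fun x => (F' (0, (E' (x, 0)).2)).1), (fun y => (F (0, (E (y, 0)).2)).1).
split.
- by apply: bop_comp => //; apply: bop_comp.
- by apply: bop_comp => //; apply: bop_comp.
- by apply: bop_comp => //; apply: bop_comp.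
- by apply: bop_comp => //; apply: bop_comp.
- do 2!(apply: bop_comp => //); apply: bop_comp => //.
  by apply: bop_comp => //; apply: bop_comp.
- do 2!(apply: bop_comp => //); apply: bop_comp => //.
  by apply: bop_comp => //; apply: bop_comp.
- by move=> y; have /(congr1 fst) := eE (y, 0).
- by move=> x; have /(congr1 fst) := eF (x, 0).
- move=> x; have /(congr1 snd) /= -> := eF (x, 0).
  by rewrite -[_ + _]/((F' _ + F' _).1) -sF' -surjective_pairing FK.
- move=> y; have /(congr1 snd) /= <- := eE (y, 0).
  by rewrite -[_ + _]/((F _ + F _).1) -sF -surjective_pairing F'K.
- move=> x; have /(congr1 fst) /= -> := eE (0, (E' (x, 0)).2).
  by rewrite (bop0 bV) addrC -[_ + _]/((E _ + E _).1) -sE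
    -surjective_pairing E'K.
- move=> y; have /(congr1 fst) /= <- := eF (0, (E (y, 0)).2).
  by rewrite (bop0 bU) -[_ + _]/((E' _ + E' _).1) -sE'
    -surjective_pairing EK.
(* In matrix entries: [E'_21 E_11 = - E'_22 E_21] by [E' E = 1], [E'_22 = F_22] by [eF], and
   [F'_12 F_22 = - F'_11 F_12] by [F' F = 1]. Hence [T Q = F'_12 E'_21 E_11 = F'_11 F_12 E_21 = J
   H]. *)
- move=> y; set p := E (y, 0).
  have -> : E' (p.1, 0) = (y, 0) - E' (0, p.2).
    by rewrite -[(y, 0)]EK -/p {2}[p]surjective_pairing (sE' p.1) addrK.
  have /(congr1 snd) /= := eF (0, p.2); rewrite (bop0 bU) => ->.
  set q := F (0, p.2); have /(congr1 fst) /= : F' q = (0, p.2) by rewrite FK.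
  have -> : (0, 0 - q.2) = - (0, q.2) :> Y * Y0.
    by congr pair; rewrite ?oppr0 ?sub0r.
  rewrite (bopN bF') {1}[q]surjective_pairing sF' /=.
  by move/eqP; rewrite addr_eq0 => /eqP ->.
Qed.

(** The identities on [X0] and [Y0] are contractible complexes: the four maps vanish there and the
    homotopies are the identity. The extended [J] gains [Y0] in its kernel and [X0] in its cokernel,
    so the two dimensions can be adjusted independently. *)
Lemma coupling_ext X Y (U : X -> X) (V : Y -> Y) J Q G S T H
    (X0 Y0 : normedModType K) :
  coupling U V J Q G S T H ->
  coupling (block_op U (fun=> 0) (fun=> 0) (@id X0))
           (block_op V (fun=> 0) (fun=> 0) (@id Y0))
    (block_op J (fun=> 0) (fun=> 0) (fun=> 0))
    (block_op Q (fun=> 0) (fun=> 0) (fun=> 0))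
    (block_op G (fun=> 0) (fun=> 0) (fun=> 0))
    (block_op S (fun=> 0) (fun=> 0) (fun=> 0))
    (block_op T (fun=> 0) (fun=> 0) id) (block_op H (fun=> 0) (fun=> 0) id).
Proof.
case=> bJ bQ bG bS bT bH eUJ eSU eJG eGJ eQS eSQ eTQ.
have b0 := @bop_zero K; have bi := @bop_id K.
split; do ?[exact: bop_block]; move=> -[x y];
  rewrite /block_op /= ?addr0 ?add0r.
- by rewrite eUJ.
- by rewrite eSU.
- by apply: injective_projections; rewrite /= ?addr0 ?add0r ?eJG.
- by apply: injective_projections; rewrite /= ?addr0 ?add0r ?eGJ.
- by apply: injective_projections; rewrite /= ?addr0 ?add0r ?eQS.
- by apply: injective_projections; rewrite /= ?addr0 ?add0r ?eSQ.
- by rewrite eTQ.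
Qed.

(* In matrix form: multiplying [T J; -S V] on the left by [1 T0; 0 1] and
   [U -Q; G H] on the right by its inverse replaces [J], [Q] by [J + T0 V],
   [Q + U T0] and keeps the matrices inverse to each other, so both of the new
   operators are invertible as soon as one is. *)
Lemma coupling_equivalent X Y (U : X -> X) (V : Y -> Y) J Q G S T H
    (T0 : Y -> X) (K' : X -> Y) :
  bounded_operator U -> bounded_operator V -> coupling U V J Q G S T H ->
  bounded_operator T0 -> inverse_operator (fun y => J y + T0 (V y)) K' ->
  exists (E : Y -> X) (F : X -> Y),
    [/\ invertible_operator E, invertible_operator F & U = E \o V \o F].
Proof.
move=> bU bV [bJ bQ bG bS bT bH eUJ eSU eJG eGJ eQS eSQ eTQ] bT0 [bK' KK' K'K].
have bK : bounded_operator (fun y => J y + T0 (V y)).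
  by apply: bop_add => //; apply: bop_comp.
pose E y := Q y + U (T0 y).
(* Up to sign, the Schur complement of [J + T0 V] in [[T - T0 S, J + T0 V; -S, V]]. *)
pose E' x := S x + V (K' (T x - T0 (S x))).
have bE : bounded_operator E by apply: bop_add => //; apply: bop_comp.
have bE' : bounded_operator E'.
  apply: bop_add => //; do 2!apply: bop_comp => //.
  by apply: bop_sub => //; apply: bop_comp.
have EVK x : E (V (K' x)) = U x.
  by rewrite /E -eUJ -(bopD bU) K'K.
exists E, K'; split.
- apply: (invertible_operatorI bE bE').
  + move=> y; rewrite /E' /E.
    have -> : T (Q y + U (T0 y)) - T0 (S (Q y + U (T0 y))) =
              J (H y - G (T0 y)) + T0 (V (H y - G (T0 y))).
      have eTU x : T (U x) = x - J (G x) by rewrite -{2}[x]eJG addrC addKr.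
      have eSQ' x : S (Q x) = x - V (H x) by rewrite -{2}[x]eSQ addrK.
      rewrite (bopD bT) (bopD bS) eTQ eTU eSU eSQ' (bopB bJ) (bopB bV).
      rewrite (bopD bT0) !(bopB bT0) opprD opprB (addrC (T0 y)) !addrA.
      by rewrite (addrAC _ (T0 y)) addrK.
    by rewrite KK' (bopD bS) eSU (bopB bV) addrA (addrAC _ _ (V (H y))) addrK.
  + move=> x; rewrite /E' (bopD bE) EVK (bopB bU) /E.
    by rewrite addrA addrAC addrK addrC eQS.
- exact: invertible_operatorI bK' bK K'K KK'.
- by apply/funext => x; rewrite /= EVK.
Qed.

End Coupling.

(** * Finite-dimensional kernels and cokernels *)

Section RowVectorMaps.
Context {K : fieldType}.

(** Take the largest [k] for which [K^k] embeds into the kernel. The spanning family bounds [k] by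
    [n], through the rank of the coefficient matrix [A]; a kernel vector outside the image would
    extend the embedding to [K^(k+1)]. *)
Lemma kernel_basis (V W : lmodType K) (J : {linear V -> W}) n (e : 'I_n -> V) :
  (forall v, J v = 0 -> exists c : 'I_n -> K, v = \sum_(i < n) c i *: e i) ->
  exists k (g : {linear 'rV[K]_k -> V}), [/\ injective g,
    forall c, J (g c) = 0 & forall v, J v = 0 -> exists c, v = g c].
Proof.
move=> spanJ.
pose P k := exists g : {linear 'rV[K]_k -> V},
  injective g /\ forall c, J (g c) = 0.
have P0 : P 0%N.
  exists (\0 : {linear 'rV[K]_0 -> V}).
  by split=> [c d _|c]; [rewrite (thinmx0 c) (thinmx0 d)|rewrite linear0].
have Pn k : P k -> (k <= n)%N.
  move=> [g [gI Jg]].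
  have /choice[m gE] i : exists m : 'rV[K]_n, g (delta_mx 0 i) =
      \sum_j m 0 j *: e j.
    have [c ->] := spanJ _ (Jg (delta_mx 0 i)).
    by exists (\row_j c j); apply: eq_bigr => j _; rewrite mxE.
  pose A := \matrix_i m i.
  have gA c : g c = \sum_j (c *m A) 0 j *: e j.
    rewrite {1}(row_sum_delta c) linear_sum.
    under eq_bigr => i _ do rewrite linearZ_LR gE scaler_sumr.
    rewrite exchange_big; apply: eq_bigr => j _.
    rewrite mxE scaler_suml; apply: eq_bigr => i _.
    by rewrite mxE scalerA.
  suff /eqP rA : row_free A by rewrite -[k in (k <= _)%N]rA rank_leq_col.
  rewrite -kermx_eq0; apply/rowV0P => c /sub_kermxP cA.
  by apply: gI; rewrite linear0 gA cA big1// => j _; rewrite mxE scale0r.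
have [||k /asboolP[g [gI Jg]] kmax] := @ex_maxnP (fun k => `[< P k >]) n.
- by exists 0%N; apply/asboolP.
- by move=> k /asboolP/Pn.
exists k, g; split=> // v Jv; apply: contrapT => nv.
pose h (c : 'rV[K]_(k + 1)) := g (lsubmx c) + (rsubmx c) 0 0 *: v.
have hl : linear h.
  move=> a c d; rewrite /h !linearP mxE mxE scalerDl scalerDr !scalerA.
  by rewrite !addrA; congr (_ + _); rewrite addrAC.
suff /kmax : `[< P (k + 1)%N >] by rewrite addn1 ltnn.
apply/asboolP; exists (pack_linear hl).
split=> [|c] /=; last first.
  by rewrite /h linearD linearZ_LR Jg Jv scaler0 addr0.
move=> c d; rewrite -[c]hsubmxK -[d]hsubmxK /h !row_mxKl !row_mxKr.
set a := rsubmx c; set b := rsubmx d => hcd.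
have ab0 : (a 0 0 - b 0 0) *: v = g (lsubmx d - lsubmx c).
  by rewrite linearB scalerBl; apply/eqP; rewrite subr_eq addrAC -hcd addrAC
    subrr add0r.
have ab : a = b.
  apply/rowP => i; rewrite !ord1; apply: contrapT => /eqP.
  rewrite -subr_eq0 => ab; apply: nv.
  exists ((a 0 0 - b 0 0)^-1 *: (lsubmx d - lsubmx c)).
  by rewrite linearZ_LR -ab0 scalerA mulVf// scale1r.
by congr row_mx => //; apply: gI; move: hcd; rewrite ab => /addIr.
Qed.

(** Take the smallest [k] for which the range of [J] and the image of some [g] on [K^k] together
    give [W]. If [g c] were in the range of [J] with [c] nonzero, a complement of the line through
    [c] would suffice, with dimension [k - 1]. *)
Lemma complement_basis (V W : lmodType K) (J : {linear V -> W}) n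
    (e : 'I_n -> W) :
  (forall w, exists v (c : 'I_n -> K), w - J v = \sum_(i < n) c i *: e i) ->
  exists k (g : {linear 'rV[K]_k -> W}),
    (forall v c, J v = g c -> c = 0) /\ forall w, exists v c, w = J v + g c.
Proof.
move=> spanJ.
pose P k := exists g : {linear 'rV[K]_k -> W},
  forall w, exists v c, w = J v + g c.
have Pn : P n.
  pose h (c : 'rV[K]_n) := \sum_i c 0 i *: e i.
  have hl : linear h.
    move=> a c d; rewrite /h scaler_sumr -big_split; apply: eq_bigr => i _.
    by rewrite !mxE scalerDl scalerA.
  exists (pack_linear hl) => w.
  have [v [c Jv]] := spanJ w; exists v, (\row_i c i).
  apply/(canRL (subrKC _)); rewrite Jv; apply: eq_bigr => i _.
  by rewrite mxE.
have [|k /asboolP[g gJ] kmin] := @ex_minnP (fun k => `[< P k >]).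
  by exists n; apply/asboolP.
exists k, g; split=> // v c Jv; apply/eqP/negPn/negP => c0.
suff /asboolP/kmin : P (\rank (c^C)%MS).
  by rewrite mxrank_compl rank_rV c0; case: (k) (c) c0 => [c' |k' _ _];
    [rewrite thinmx0 eqxx|rewrite subn1 ltnn].
exists (g \o mulmxr (row_base (c^C)%MS)) => w.
have [v1 [c1 ->]] := gJ w.
have /sub_addsmxP[[a b] /= c1E] : (c1 <= c + c^C)%MS.
  by rewrite submx_full// addsmx_compl_full.
have /submxP[d dE] : (b *m (c^C)%MS <= row_base (c^C)%MS)%MS.
  by rewrite eq_row_base submxMl.
exists (v1 + a 0 0 *: v), d; rewrite c1E dE /= linearD linearD addrA.
congr (_ + _ + _); rewrite linearZ_LR Jv -linearZ_LR; congr (g _).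
by rewrite [a in LHS]mx11_scalar mul_scalar_mx.
Qed.

End RowVectorMaps.

(** * Completeness of direct sums *)

Section ProductComplete.
Context {T U : completeType}.

HB.instance Definition _ := Pointed.on (T * U)%type.

(** Makes [X * X0] and [Y * Y0] Banach spaces, so that the bounded inverse theorem applies to
    operators between them. *)
Lemma prod_complete (F : set_system (T * U)) :
  ProperFilter F -> cauchy F -> cvg F.
Proof.
move=> FF Fc.
have c1 : cauchy (fst @ F).
  move=> A entA; rewrite near_simpl -near2E near_map2.
  have := Fc _ (prod_entP entA (@entourageT U)).
  by apply: filterS => -[] [x1 y1] [x2 y2] [].
have c2 : cauchy (snd @ F).
  move=> A entA; rewrite near_simpl -near2E near_map2.
  have := Fc _ (prod_entP (@entourageT T) entA).
  by apply: filterS => -[] [x1 y1] [x2 y2] [].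
have cl1 : fst @ F --> lim (fst @ F) by exact: cauchy_cvg c1.
have cl2 : snd @ F --> lim (snd @ F) by exact: cauchy_cvg c2.
apply: (cvgP (lim (fst @ F), lim (snd @ F))).
move=> A /(cvg_pair cl1 cl2); rewrite !nbhs_simpl.
by have -> : (fun x : T * U => (x.1, x.2)) = id by apply/funext => -[].
Qed.

End ProductComplete.

HB.instance Definition _ (K : numFieldType) (X Y : completeNormedModType K) :=
  Uniform_isComplete.Build (X * Y)%type prod_complete.

(** * Finite-rank operators and bounded left inverses *)

Section FiniteRank.
Context {K : numFieldType}.

Lemma bop_rV n (W : normedModType K) (f : {linear 'rV[K]_n -> W}) :
  bounded_operator f.
Proof.
have -> : (f : 'rV[K]_n -> W) = fun c => \sum_i c 0 i *: f (delta_mx 0 i).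
  apply/funext => c; rewrite {1}(row_sum_delta c) linear_sum.
  by apply: eq_bigr => i _; rewrite linearZ_LR.
apply: bop_sumr => i; apply: bop_scale; apply/bounded_operatorP; split.
  by move=> a c d; rewrite !mxE.
exact: coord_continuous.
Qed.

(** The consequence of Hahn-Banach that the argument uses, stated as a property of the scalar field
    so that one proof serves real and complex scalars. *)
Definition separating := forall (V : normedModType K) (v : V), v != 0 ->
  exists2 f : V -> K^o, bounded_operator f & f v != 0.

(** Functionals are collected one at a time: while [p g] has a nonzero kernel vector [c], a
    functional not vanishing at [g c] is adjoined to [p] as a new coordinate. Once the rank is [n],
    a right inverse [B] of the matrix corrects [p]. *)
Lemma bounded_left_inverse (V : normedModType K) n
    (g : {linear 'rV[K]_n -> V}) :
  separating -> injective g ->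
  exists2 p : V -> 'rV[K]_n, bounded_operator p & cancel g p.
Proof.
move=> sep gI.
suff [k [p bp /row_freeP[B AB]]] : exists k, exists2 p : V -> 'rV[K]_k,
    bounded_operator p & row_free (lin1_mx (p \o g)).
  exists (fun v => p v *m B) => [|c].
    exact: bop_comp (bop_rV (mulmxr B)) bp.
  have pl : linear (p \o g) by move=> a x y; rewrite /= linearP bp.1.
  by rewrite -[p _](mul_rV_lin1 (pack_linear pl)) -mulmxA AB mulmx1.
suff H r : (r <= n)%N -> exists k, exists2 p : V -> 'rV[K]_k,
    bounded_operator p & (r <= \rank (lin1_mx (p \o g)))%N.
  have [k [p bp rp]] := H n (leqnn n); exists k, p => //.
  by rewrite /row_free eqn_leq rank_leq_row.
elim: r => [_|r IHr rn].
  by exists 0%N, (fun=> 0) => //; exact: bop_zero.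
have [k [p bp rp]] := IHr (ltnW rn).
have [rlt|rge] := ltnP r (\rank (lin1_mx (p \o g))); first by exists k, p.
set A := lin1_mx _ in rp rge.
have pl : linear (p \o g) by move=> a x y; rewrite /= linearP bp.1.
have AE c : c *m A = p (g c) by rewrite (mul_rV_lin1 (pack_linear pl)).
have /rowV0Pn[c /sub_kermxP cA c0] : kermx A != 0.
  by rewrite kermx_eq0 /row_free neq_ltn (leq_ltn_trans rge rn).
have gc0 : g c != 0 by rewrite raddf_eq0.
have [f bf fc] := sep _ _ gc0.
pose q v := p v *m row_mx 1%:M 0 + f v *: row_mx (0 : 'rV[K]_k) (1 : 'rV[K]_1).
have bq : bounded_operator q.
  apply: bop_add; first exact: bop_comp (bop_rV (mulmxr (row_mx 1%:M 0))) bp.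
  exact: bop_scale.
exists (k + 1)%N, q => //.
have ql : linear (q \o g) by move=> a x y; rewrite /= linearP bq.1.
set B := lin1_mx _.
have BE d : d *m B = row_mx (p (g d)) (f (g d))%:M.
  rewrite (mul_rV_lin1 (pack_linear ql)) /= /q mul_mx_row mulmx1 mulmx0.
  rewrite scale_row_mx scaler0 add_row_mx addr0 add0r.
  by rewrite -[1]/(1%:M) scalemx1.
(* The kernel shrinks strictly, as [c] has left it; by rank-nullity the rank grows. *)
have : (kermx B < kermx A)%MS.
  rewrite ltmxE; apply/andP; split.
    apply/rV_subP => d /sub_kermxP; rewrite BE -row_mx0 => /eq_row_mx[pd _].
    by apply/sub_kermxP; rewrite AE.
  apply/negP => /rV_subP/(_ c); rewrite !sub_kermx cA eqxx.
  move=> /(_ isT) /eqP; rewrite BE -row_mx0 => /eq_row_mx[_ /matrixP/(_ 0 0)].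
  by rewrite !mxE => /eqP; rewrite (negPf fc).
move=> /rank_ltmx; rewrite !mxrank_ker => kerlt.
apply: leq_ltn_trans rp _; move: kerlt; rewrite !ltnNge; apply: contra.
exact: leq_sub2l.
Qed.

End FiniteRank.

(** * Inessential operators *)

Section InessentialCoupling.
Context {K : numFieldType}.

Definition bounded_inverse_property :=
  forall (V W : completeNormedModType K) (T : V -> W),
  bounded_operator T -> injective T -> (forall w, exists v, T v = w) ->
  exists T', inverse_operator T T'.

Definition complete_field :=
  forall F : set_system K, ProperFilter F -> cauchy F -> cvg F.

(** Since [G J + H V = 1], [V] is injective on the kernel of [J], so [V g] has a bounded left
    inverse [p]. With [T0 = f p], the operator [T0 V] maps this kernel bijectively onto the
    complement given by [f], and [J + T0 V] is bijective. *)
Lemma Fredholm_coupling_equivalent (X Y : completeNormedModType K)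
    (U : X -> X) (V : Y -> Y) J Q G S T H k l
    (g : {linear 'rV[K]_k -> Y}) (f : {linear 'rV[K]_l -> X}) :
  @separating K -> bounded_inverse_property ->
  bounded_operator U -> bounded_operator V -> coupling U V J Q G S T H ->
  k = l ->
  injective g -> (forall c, J (g c) = 0) ->
  (forall v, J v = 0 -> exists c, v = g c) ->
  (forall v c, J v = f c -> c = 0) ->
  (forall w, exists v c, w = J v + f c) ->
  exists (E : Y -> X) (F : X -> Y),
    [/\ invertible_operator E, invertible_operator F & U = E \o V \o F].
Proof.
move=> sep inv bU bV cUV kl; case: l / kl f => f gI Jg kerJ fI ranJ.
have bJ := coupling_bJ cUV.
have Vgl : linear (V \o g) by move=> a c d; rewrite /= linearP bV.1.
have VgI : injective (pack_linear Vgl).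
  apply/raddf_inj => c /= Vgc; apply: gI; rewrite linear0.
  by rewrite -[g c](coupling_GJ cUV) Jg Vgc (bop0 (coupling_bG cUV))
    (bop0 (coupling_bH cUV)) addr0.
have [p bp pK] := bounded_left_inverse sep VgI.
have bT0 : bounded_operator (fun y => f (p y)).
  by apply: bop_comp => //; exact: bop_rV.
have bJ' : bounded_operator (fun y => J y + f (p (V y))).
  by apply: bop_add => //; exact: bop_comp bT0 bV.
have [||K' K'P] := inv Y X _ bJ'.
- apply: (@raddf_inj _ _ (pack_linear bJ'.1)) => y /= /eqP.
  rewrite addr_eq0 -linearN => /eqP yz0.
  have /eqP := fI _ _ yz0; rewrite oppr_eq0 => /eqP py0.
  have [c yE] : exists c, y = g c.
    by apply: kerJ; rewrite yz0 py0 oppr0 linear0.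
  by rewrite yE -(pK c) /= -yE py0 linear0.
(* Adding a kernel element leaves [J y] alone and moves the complement coordinate from [p (V y)] to
   [c]. *)
- move=> x; have [y [c ->]] := ranJ x; exists (y + g (c - p (V y))).
  rewrite (bopD bJ) Jg addr0 (bopD bV) (bopD bp); congr (_ + f _).
  by rewrite [p (V (g _))](pK) subrKC.
exact: coupling_equivalent bU bV cUV bT0 K'P.
Qed.

Lemma rV_complete n : complete_field ->
  forall F : set_system 'rV[K]_n, ProperFilter F -> cauchy F -> cvg F.
Proof.
move=> cK; pose Kc : completeType := HB.pack K (Uniform_isComplete.Build K cK).
exact: (@mx_complete Kc 1 n).
Qed.

Definition rV_banach (cK : complete_field) n : completeNormedModType K :=
  HB.pack 'rV[K]_n (Uniform_isComplete.Build 'rV[K]_n (@rV_complete n cK)).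

Lemma inessential_EAOE_finite_dim (X Y : completeNormedModType K)
    (U : X -> X) (V : Y -> Y) :
  @separating K -> bounded_inverse_property -> complete_field ->
  bounded_operator U -> bounded_operator V ->
  inessential U -> inessential V -> EAE U V -> EAOE_finite_dim U V.
Proof.
move=> sep inv cK bU bV iU iV /(EAE_coupling bU bV)[J [Q [G [S [T [H cUV]]]]]].
have bJ := coupling_bJ cUV.
have [n [g [gI Jg kerJ]]] : exists n (g : {linear 'rV[K]_n -> Y}),
    [/\ injective g, forall c, J (g c) = 0 &
        forall v, J v = 0 -> exists c, v = g c].
  (* The kernel of [J] lies in that of the Fredholm operator [1 - H V]. *)
  have [[n [e eE]] _] := iV _ (coupling_bH cUV).
  apply: (@kernel_basis _ _ _ (pack_linear bJ.1) n e) => v /= Jv.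
  suff : [set v | v - H (V v) = 0] v by rewrite eE.
  rewrite /= -{1}[v](coupling_GJ cUV) Jv (bop0 (coupling_bG cUV)) add0r.
  exact: subrr.
have [m [f [fI ranJ]]] : exists m (f : {linear 'rV[K]_m -> X}),
    (forall v c, J v = f c -> c = 0) /\ forall w, exists v c, w = J v + f c.
  (* The range of [J] contains that of the Fredholm operator [1 - T U = J G]. *)
  have [_ [m [e eE]]] := iU _ (coupling_bT cUV).
  apply: (@complement_basis _ _ _ (pack_linear bJ.1) m e) => w.
  have [_ [x _ <-] [c wE]] := eE w; exists (G x), c.
  by rewrite -wE /= -{2}[x](coupling_JG cUV) addrK.
(* Subtraction is truncated, so at least one of the two spaces is zero, and both [n + (m - n)] and
   [m + (n - m)] equal the maximum of [m] and [n]. *)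
pose X0 := rV_banach cK (n - m); pose Y0 := rV_banach cK (m - n).
have fd k : finite_dim_space (rV_banach cK k).
  exists k, (fun i => delta_mx 0 i : 'rV[K]_k).
  apply/seteqP; split=> // c _; exists (fun i => (c : 'rV[K]_k) 0 i).
  exact: row_sum_delta.
exists X0, Y0; split; [exact: fd|exact: fd| |].
  have triv k : k = 0%N -> trivial_space (rV_banach cK k).
    move=> ->; apply/seteqP; split=> // c _ /=.
    exact: (thinmx0 (c : 'rV[K]_0)).
  by case: (leqP n m) => nm; [left|right]; apply: triv;
    apply/eqP; rewrite subn_eq0 // ltnW.
pose gh (c : 'rV[K]_(n + (m - n))) : Y * Y0 := (g (lsubmx c), rsubmx c).
pose fh (c : 'rV[K]_(m + (n - m))) : X * X0 := (f (lsubmx c), rsubmx c).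
have ghl : linear gh by move=> a c d; rewrite /gh !linearP.
have fhl : linear fh by move=> a c d; rewrite /fh !linearP.
have b0 := @bop_zero K; have bi := @bop_id K.
apply: (@Fredholm_coupling_equivalent _ _ _ _ _ _ _ _ _ _ _ _
  (pack_linear ghl) (pack_linear fhl) sep inv _ _ (coupling_ext X0 Y0 cUV)).
- exact: bop_block.
- exact: bop_block.
- by rewrite -!maxnE maxnC.
- move=> c d /= [/gI cd1 cd2].
  by rewrite -[c]hsubmxK -[d]hsubmxK cd1; congr row_mx.
- by move=> c; rewrite /block_op /= Jg !addr0.
- move=> [y z] [/= + _]; rewrite addr0 => /kerJ[c ->].
  by exists (row_mx c z); rewrite /gh row_mxKl row_mxKr.
- move=> [y z] c [/=]; rewrite !addr0 => /fI c1 c2.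
  by rewrite -[c]hsubmxK c1 -c2 row_mx0.
- move=> [x z]; have [y [c ->]] := ranJ x.
  exists (y, 0), (row_mx c z).
  rewrite /fh /block_op /= row_mxKl row_mxKr.
  by apply: injective_projections; rewrite /= ?addr0 ?add0r.
Qed.

Lemma inessential_equivalences (X Y : completeNormedModType K)
    (U : X -> X) (V : Y -> Y) :
  @separating K -> bounded_inverse_property -> complete_field ->
  bounded_operator U -> bounded_operator V ->
  inessential U -> inessential V ->
  ((EAE U V <-> EAOE U V) /\ (EAOE U V <-> Schur_coupled U V)) /\
  (EAE U V -> EAE_finite_dim U V /\ EAOE_finite_dim U V).
Proof.
move=> sep inv cK bU bV iU iV.
have fin : EAE U V -> EAOE_finite_dim U V.
  exact: inessential_EAOE_finite_dim.
have one : EAE U V -> EAOE U V.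
  by move=> /fin[X0 [Y0 [_ _ triv e]]]; exists X0, Y0.
split; last first.
  move=> /fin e; split=> //.
  by have [X0 [Y0 [fX0 fY0 _ {}e]]] := e; exists X0, Y0.
split; split=> //.
- by move=> [X0 [Y0 [_ e]]]; exists X0, Y0.
- exact: EAOE_Schur_coupled.
- by move=> /Schur_coupled_EAE/one.
Qed.

End InessentialCoupling.

(** * The Hahn-Banach theorem *)

Section HahnBanach.
Context {R : realType} {V : lmodType R} (p : V -> R).
Context (pD : forall x y, p (x + y) <= p x + p y).
Context (pZ : forall a x, p (a *: x) = `|a| * p x).

(* [G] is empty or the graph of a linear functional on a subspace of [V]; it is
   single-valued because [r <= p 0 = 0] for all [(0, r)] in [G]. *)
Definition dominated_graph (G : set (V * R)) : Prop :=
  (forall a u v, G u -> G v -> G (a *: u.1 + v.1, a * u.2 + v.2)) /\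
  (forall u, G u -> u.2 <= p u.1).

(** The value [c] at [x0] has to lie above all [u.2 - p (u.1 - x0)] and below all
    [p (u.1 + x0) - u.2]. Subadditivity of [p] separates the two families, so the supremum of the
    first serves; homogeneity carries the bound to every multiple of [x0]. *)
Lemma dominated_graph_extend (G : set (V * R)) (x0 : V) :
  dominated_graph G -> G !=set0 ->
  exists c, dominated_graph
    [set w | exists t, exists2 u, G u & w = (u.1 + t *: x0, u.2 + t * c)].
Proof.
move=> [lG pG] [u0 Gu0].
pose A := [set u.2 - p (u.1 - x0) | u in G].
have ubA u : G u -> ubound A (p (u.1 + x0) - u.2).
  move=> Gu _ [v Gv <-].
  have := pG _ (lG 1 _ _ Gu Gv); rewrite /= scale1r mul1r => uv.
  have := pD (u.1 + x0) (v.1 - x0); rewrite addrACA subrr addr0.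
  by move: uv; lra.
have supA : has_sup A.
  by split; [exists (u0.2 - p (u0.1 - x0)), u0|eexists; exact: ubA Gu0].
have c_ge u : G u -> u.2 - p (u.1 - x0) <= sup A.
  by move=> Gu; apply: (ub_le_sup supA.2); exists u.
have c_le u : G u -> sup A <= p (u.1 + x0) - u.2.
  by move=> Gu; apply: (ge_sup supA.1); exact: ubA.
have G0 : G (0, 0).
  have := lG (- 1) _ _ Gu0 Gu0.
  by rewrite scaleN1r mulN1r !addNr.
have GZ a u : G u -> G (a *: u.1, a * u.2).
  by move=> Gu; have := lG a _ _ Gu G0; rewrite !addr0.
exists (sup A); split.
- move=> a _ _ [s [u Gu ->]] [t [v Gv ->]] /=.
  exists (a * s + t), (a *: u.1 + v.1, a * u.2 + v.2); first exact: lG.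
  congr pair => /=; first by rewrite scalerDr scalerDl scalerA addrACA.
  by rewrite mulrDr mulrDl mulrA addrACA.
- move=> _ [t [u Gu ->]] /=; have [t0|t0|->] := ltrgt0P t.
  + have := c_le _ (GZ t^-1 _ Gu); rewrite lerBrDr /=.
    rewrite -(ler_pM2l t0) mulrDr mulVKf ?gt_eqF// addrC => /le_trans; apply.
    by rewrite -[X in X * _]gtr0_norm// -pZ scalerDr scalerA mulfV ?gt_eqF//
      scale1r.
  + have := c_ge _ (GZ (- t)^-1 _ Gu); rewrite lerBlDr /=.
    have nt0 : 0 < - t by rewrite oppr_gt0.
    rewrite -(ler_pM2l nt0) mulrDr mulVKf ?gt_eqF// mulNr -lerBlDl opprK.
    move=> /le_trans; apply.
    rewrite -[X in X * _]gtr0_norm// -pZ scalerBr scalerA mulfV ?gt_eqF//.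
    by rewrite scale1r scaleNr opprK.
  + by rewrite scale0r mul0r !addr0; exact: pG.
Qed.

Theorem Hahn_Banach (v : V) :
  exists f : V -> R, [/\ scalar f, f v = p v & forall x, f x <= p x].
Proof.
have p0 : p 0 = 0 by rewrite -(scale0r 0) pZ normr0 mul0r.
have pN x : p (- x) = p x by rewrite -scaleN1r pZ normrN1 mul1r.
have p_ge0 x : 0 <= p x.
  by have := pD x (- x); rewrite subrr p0 pN -mulr2n pmulrn_lge0.
pose P (G : set (V * R)) := dominated_graph G /\ (G !=set0 -> G (v, p v)).
have [|G [[dG Gv] maxG]] := @Zorn_bigcup _ P.
  move=> F FP totF; split; first split.
  - move=> a u w [A FA Au] [B FB Bw].
    have [AB|BA] := totF _ _ FA FB.
      by exists B => //; apply: (FP _ FB).1.1 => //; exact: AB.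
    by exists A => //; apply: (FP _ FA).1.1 => //; exact: BA.
  - by move=> u [A FA Au]; exact: (FP _ FA).1.2.
  - move=> [u [A FA Au]]; exists A => //.
    by apply: (FP _ FA).2; exists u.
(* Otherwise the graph on the line through [v] would be strictly larger. *)
have G0 : G !=set0.
  apply: contrapT => G0.
  pose L := [set (a *: v, a * p v) | a in [set: R]].
  apply: (maxG L).
    split=> [u Gu|/(_ (0, 0))]; first by case: G0; exists u.
    move=> LG; apply: G0; exists (0, 0); apply: LG; exists 0 => //.
    by rewrite scale0r mul0r.
  split; last by move=> _; exists 1; rewrite // scale1r mul1r.
  split=> [a _ _ [s _ <-] [t _ <-]|_ [s _ <-]] /=.
    by exists (a * s + t) => //; rewrite scalerDl mulrDl scalerA mulrA.
  by rewrite pZ ler_wpM2r// ler_norm.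
have [[lG pG] {}Gv] := (dG, Gv G0).
have Gfun x a b : G (x, a) -> G (x, b) -> a = b.
  move=> Ga Gb; apply/eqP; rewrite eq_le; apply/andP; split; rewrite -subr_le0.
    by have := pG _ (lG (- 1) _ _ Gb Ga);
      rewrite /= scaleN1r mulN1r addNr p0 addrC.
  by have := pG _ (lG (- 1) _ _ Ga Gb);
    rewrite /= scaleN1r mulN1r addNr p0 addrC.
have Gtot x : exists a, G (x, a).
  apply: contrapT => nGx.
  have [c dG'] := dominated_graph_extend x dG G0.
  set G' := [set w | _] in dG'.
  have GG' : G `<=` G'.
    move=> u Gu; exists 0, u => //.
    by rewrite scale0r mul0r !addr0 -surjective_pairing.
  apply: (maxG G').
    split=> // G'G; apply: nGx; exists c; apply: G'G.
    exists 1, (0, 0); last by rewrite scale1r mul1r !add0r.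
    by have := lG (- 1) _ _ Gv Gv; rewrite scaleN1r mulN1r !addNr.
  by split=> // _; exact: GG'.
have [f Gf] := choice Gtot.
exists f; split.
- move=> a x y; apply: (Gfun (a *: x + y)) => //.
  exact: (lG a (x, f x) (y, f y)).
- exact: (Gfun v).
- by move=> x; exact: (pG (x, f x)).
Qed.

End HahnBanach.

Lemma real_separating (R : realType) : @separating R.
Proof.
move=> V v v0.
have [f [fl fv fp]] := @Hahn_Banach R V (fun x => `|x|) (@ler_normD _ _)
  (@normrZ _ _) v.
exists f; last by rewrite fv normr_eq0.
apply/bounded_operator_normP; split=> //; exists 1 => // x.
rewrite mul1r ler_norml fp andbT lerNl -normrN.
by rewrite -[leLHS](linearN (pack_linear fl : {linear V -> R^o})) fp.
Qed.

(** * The bounded inverse theorem *)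

Section BoundedInverse.
Context {R : realType} {V W : completeNormedModType R} (T : V -> W).
Context (bT : bounded_operator T) (Tsurj : forall w, exists v, T v = w).

(* Baire: the closure of the image of some ball of [V] has nonempty interior. *)
Lemma approximate_preimage :
  exists2 C, 0 < C & forall w, exists2 v, `|v| <= C * `|w| &
    `|w - T v| <= `|w| / 2.
Proof.
pose A (n : nat) := [set T v | v in [set v | `|v| <= n%:R]].
have [n nd] : exists n, ~ dense (~` closure (A n)).
  apply: contrapT => /forallNP d.
  have /(_ setT) : dense (\bigcap_n ~` closure (A n)).
    by apply: Baire => n; split;
      [exact/closed_openC/closed_closure|exact: contrapT (d n)].
  case=> [||w [_ wA]]; [by exists 0|exact: openT|].
  have [v Tv] := Tsurj w.
  apply: (wA (Num.truncn `|v|).+1 I); apply: subset_closure; exists v => //=.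
  by rewrite ltW// truncnS_gt.
have [w0 [r r0 ballA]] :
    exists w0, exists2 r, 0 < r & ball w0 r `<=` closure (A n).
  move: nd => /denseNE[D [[w0 /open_nbhs_nbhs /nbhs_ballP[r r0 bD]] DA]].
  exists w0, r => // w /bD Dw; apply: contrapT => nA.
  by have : (D `&` ~` closure (A n)) w by []; rewrite DA.
have approx w e : `|w0 - w| < r -> 0 < e ->
    exists2 v, `|v| <= n%:R & `|w - T v| < e.
  move=> w0w e0; have : closure (A n) w by apply: ballA; rewrite -ball_normE.
  move=> /(_ _ (nbhsx_ballx w e e0))[_ [[v vn <-]]].
  by rewrite -ball_normE; exists v.
(* The preimage will be [t^-1 *: (v1 - v2)] with [t^-1 = 2 |w| / r] and [|v1 - v2| <= 2 n]; [n + 1]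
   replaces [n] to keep the constant positive. *)
exists (4 * n.+1%:R / r); first by rewrite !mulr_gt0// invr_gt0.
move=> w; have [->|w_neq0] := eqVneq w 0.
  by exists 0; rewrite ?(bop0 bT) ?subr0 !normr0 ?mulr0 ?mul0r.
have w_gt0 : 0 < `|w| by rewrite normr_gt0.
pose t := r / 2 / `|w|.
have t0 : 0 < t by rewrite !divr_gt0.
have tE : t * `|w| = r / 2 by rewrite mulfVK// gt_eqF.
(* Two errors of [r / 8] add up to [r / 4], which is half of [t * |w|]. *)
have e0 : 0 < r / 8 by rewrite divr_gt0.
have [|v1 v1n v1e] := approx (w0 + t *: w) _ _ e0.
  by rewrite opprD addNKr normrN normrZ gtr0_norm// tE; lra.
have [|v2 v2n v2e] := approx w0 _ _ e0.
  by rewrite subrr normr0.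
exists (t^-1 *: (v1 - v2)).
  rewrite normrZ gtr0_norm ?invr_gt0// invf_div invf_div.
  have := ler_normB v1 v2; rewrite -[n.+1%:R]natr1 => v12.
  rewrite [leRHS](_ : _ = `|w| * (2 / r) * (2 * (n%:R + 1))).
    by rewrite ler_wpM2l ?mulr_ge0 ?invr_ge0// ?ltW//; move: v1n v2n v12; lra.
  by field; rewrite gt_eqF.
have -> : w - T (t^-1 *: (v1 - v2)) =
    t^-1 *: ((w0 + t *: w - T v1) - (w0 - T v2)).
  have -> : w0 + t *: w - T v1 - (w0 - T v2) = t *: w - (T v1 - T v2).
    rewrite !opprB (addrC w0) -!addrA; congr (_ + _).
    by rewrite addrC -!addrA addNr addr0 addrC.
  by rewrite (bopZ bT) (bopB bT) [RHS]scalerBr scalerA mulVf ?gt_eqF// scale1r.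
rewrite normrZ gtr0_norm ?invr_gt0// -(ler_pM2l t0) mulVKf ?gt_eqF//.
rewrite mulrA tE; apply: le_trans (ler_normB _ _) _.
by move: v1e v2e; lra.
Qed.

(** Approximate solutions are applied repeatedly to the remaining error, which halves each time. The
    corrections are dominated by a geometric series of sum [2 C |w|], so they sum to an exact
    preimage by completeness of [V]. *)
Lemma bounded_preimage :
  exists2 C, 0 < C & forall w, exists2 v, `|v| <= C * `|w| & T v = w.
Proof.
have [C C0 approx] := approximate_preimage.
have /choice[h hP] w : exists v, `|v| <= C * `|w| /\ `|w - T v| <= `|w| / 2.
  by have [v] := approx w; exists v.
exists (C * 2); first by rewrite mulr_gt0.
move=> w; pose err k := iter k (fun w => w - T (h w)) w.
have err_le k : `|err k| <= `|w| * 2^-1 ^+ k.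
  elim: k => [|k IH]; first by rewrite expr0 mulr1.
  apply: le_trans (hP _).2 _; rewrite exprSr mulrA.
  by rewrite ler_wpM2r.
pose u k := h (err k).
have u_le k : `|u k| <= geometric (C * `|w|) 2^-1 k.
  apply: le_trans (hP _).1 _; rewrite /= -mulrA.
  by rewrite ler_wpM2l// ltW.
have half1 : `|2^-1 : R| < 1 by rewrite gtr0_norm ?invr_gt0//; lra.
have geo := @cvg_geometric_series R (C * `|w|) _ half1.
have ucvg : cvgn [normed series u].
  apply: (series_le_cvg _ _ u_le (cvgP _ geo)) => k; first exact: normr_ge0.
  exact: le_trans (normr_ge0 _) (u_le k).
exists (limn (series u)).
  apply: le_trans (lim_series_norm ucvg) _.
  rewrite (_ : C * 2 * `|w| = C * `|w| * (1 - 2^-1)^-1); last by field.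
  rewrite -(cvg_lim _ geo)//; apply: lim_series_le => //.
  exact: cvgP geo.
have Tseries k : T (series u k) = w - err k.
  elim: k => [|k IH].
    by rewrite /series /= big_nil (bop0 bT) subrr.
  by rewrite seriesSr (bopD bT) IH /= opprB addrA addrAC.
have err_cvg0 : err k @[k --> \oo] --> (0 : W).
  apply/norm_cvg0P.
  apply: (@squeeze_cvgr _ _ _ _ (cst 0) (geometric `|w| 2^-1)).
  - by apply: nearW => k; rewrite normr_ge0 err_le.
  - exact: cvg_cst.
  - exact: cvg_geometric.
have /bounded_operatorP[_ cT] := bT.
apply: (@cvg_unique _ _ (T (series u k) @[k --> \oo])).
- exact: norm_hausdorff.
- exact: (cvg_comp _ _ (normed_cvg ucvg) (cT _)).
- rewrite (_ : (fun k => _) = fun k => w - err k); last exact/funext.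
  have : w - err k @[k --> \oo] --> w - 0 by apply: cvgB => //; exact: cvg_cst.
  by rewrite subr0.
Qed.

End BoundedInverse.

Lemma real_bounded_inverse (R : realType) : @bounded_inverse_property R.
Proof.
move=> V W T bT TI Tsurj.
have [C C0 preim] := bounded_preimage bT Tsurj.
have /choice[T' T'P] w : exists v, `|v| <= C * `|w| /\ T v = w.
  by have [v] := preim w; exists v.
have T'K w : T (T' w) = w by have [] := T'P w.
exists T'; split; [|by move=> v; apply: TI|exact: T'K].
apply/bounded_operator_normP; split; last by exists C => // w; exact: (T'P w).1.
by move=> a x y; apply: TI; rewrite bT.1 !T'K.
Qed.

(** * Complex scalars *)

Lemma real_complete_field (R : realType) : @complete_field R.
Proof. exact: R_complete. Qed.

Section ComplexScalars.
Context {R : realType}.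
Local Open Scope complex_scope.
Local Notation Re := complex.Re.
Local Notation Im := complex.Im.

Lemma normc_Re (z : R[i]) : `|Re z| <= Re `|z|.
Proof.
rewrite normc_def /= -sqrtr_sqr ler_sqrt ?addr_ge0 ?sqr_ge0//.
by rewrite lerDl sqr_ge0.
Qed.

Lemma normc_Im (z : R[i]) : `|Im z| <= Re `|z|.
Proof.
rewrite normc_def /= -sqrtr_sqr ler_sqrt ?addr_ge0 ?sqr_ge0//.
by rewrite lerDr sqr_ge0.
Qed.

Lemma normc_real (x : R) : `|x%:C| = `|x|%:C.
Proof. by rewrite normc_def /= expr0n /= addr0 sqrtr_sqr. Qed.

Lemma gt0_complex_real (e : R[i]) : 0 < e -> exists2 r : R, 0 < r & e = r%:C.
Proof.
move=> e0; have /complex_realP[r er] : e \is Num.real by rewrite gtr0_real.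
by exists r; rewrite // -ltcR -er.
Qed.

(** Real and imaginary parts do not increase distances, so both images of a Cauchy filter are
    Cauchy; their limits are the parts of the limit. *)
Lemma complex_complete_field : @complete_field R[i].
Proof.
move=> F FF /cauchy_ballP Fc.
have cRe : cauchy (@Re R @ F).
  apply/cauchy_ballP => e e0; rewrite near_map2.
  have := Fc e%:C; rewrite ltcR => /(_ e0); apply: filterS => -[x y] /=.
  rewrite -!ball_normE /= -raddfB ltcE => /andP[_]; apply: le_lt_trans.
  exact: normc_Re.
have cIm : cauchy (@Im R @ F).
  apply/cauchy_ballP => e e0; rewrite near_map2.
  have := Fc e%:C; rewrite ltcR => /(_ e0); apply: filterS => -[x y] /=.
  rewrite -!ball_normE /= -raddfB ltcE => /andP[_]; apply: le_lt_trans.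
  exact: normc_Im.
pose l := lim (@Re R @ F) +i* lim (@Im R @ F).
apply/cvg_ex; exists l; apply/cvgrPdist_lt => _ /gt0_complex_real[r r0 ->].
have r2 : 0 < r / 2 by rewrite divr_gt0.
have /cvgrPdist_lt/(_ _ r2) : @Re R @ F --> lim (@Re R @ F).
  exact: cauchy_cvg cRe.
have /cvgrPdist_lt/(_ _ r2) : @Im R @ F --> lim (@Im R @ F).
  exact: cauchy_cvg cIm.
rewrite !near_simpl; apply: filterS2 => z Imz Rez.
rewrite [l - z]complexE; apply: le_lt_trans (ler_normD _ _) _.
rewrite normrM !normc_real (_ : `|'i| = 1); last first.
  by rewrite normc_def /= expr0n expr1n add0r sqrtr1.
rewrite mul1r -rmorphD ltcR [r]splitr !raddfB /=.
exact: ltrD.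
Qed.


(* A complex normed space with its scalars restricted to the reals. *)
Definition realified (X : normedModType R[i]) : Type := X.

Section Realified.
Context (X : normedModType R[i]).
Local Notation XR := (realified X).

HB.instance Definition _ := PointedUniform.copy XR X.
HB.instance Definition _ := GRing.Zmodule.copy XR X.

(** The norm of [X] takes values in [R[i]]; they are real, so the real part loses nothing. *)
Definition realified_norm (x : XR) : R := Re `|x : X|.
Definition realified_scale (a : R) (x : XR) : XR := a%:C *: (x : X).

Lemma realified_normE (x : X) : `|x| = (realified_norm x)%:C.
Proof. by rewrite RRe_real// normr_real. Qed.

Lemma realified_scaleA a b x :
  realified_scale a (realified_scale b x) = realified_scale (a * b) x.
Proof. by rewrite /realified_scale scalerA rmorphM. Qed.

Lemma realified_scale1 : left_id 1 realified_scale.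
Proof. by move=> x; rewrite /realified_scale scale1r. Qed.

Lemma realified_scaleDr : right_distributive realified_scale +%R.
Proof. by move=> a x y; rewrite /realified_scale scalerDr. Qed.

Lemma realified_scaleDl x :
  {morph realified_scale^~ x : a b / a + b}.
Proof. by move=> a b; rewrite /realified_scale rmorphD scalerDl. Qed.

HB.instance Definition _ := GRing.Zmodule_isLmodule.Build R XR
  realified_scaleA realified_scale1 realified_scaleDr realified_scaleDl.

Lemma realified_ler_normD (x y : XR) :
  realified_norm (x + y) <= realified_norm x + realified_norm y.
Proof.
by rewrite -lecR rmorphD /= -!realified_normE; exact: (@ler_normD _ X).
Qed.

Lemma realified_norm0_eq0 (x : XR) : realified_norm x = 0 -> x = 0.
Proof.
by move=> x0; apply/(@normr0_eq0 _ X); rewrite realified_normE x0.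
Qed.

Lemma realified_normrMn (x : XR) n :
  realified_norm (x *+ n) = realified_norm x *+ n.
Proof.
apply: (@complexI R); rewrite rmorphMn /= -!realified_normE.
exact: (@normrMn _ X).
Qed.

Lemma realified_normrN (x : XR) : realified_norm (- x) = realified_norm x.
Proof.
by apply: (@complexI R); rewrite -!realified_normE; exact: (@normrN _ X).
Qed.

HB.instance Definition _ := Num.Zmodule_isNormed.Build R XR
  realified_ler_normD realified_norm0_eq0 realified_normrMn realified_normrN.

Definition realified_ball (x : XR) (e : R) : set XR := ball (x : X) e%:C.

Lemma realified_ball_center x e : 0 < e -> realified_ball x e x.
Proof. by move=> e0; apply: ballxx; rewrite ltcR. Qed.

Lemma realified_ball_sym x y e : realified_ball x e y -> realified_ball y e x.
Proof. exact: ball_sym. Qed.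

Lemma realified_ball_triangle x y z e1 e2 :
  realified_ball x e1 y -> realified_ball y e2 z ->
  realified_ball x (e1 + e2) z.
Proof. by rewrite /realified_ball rmorphD; exact: ball_triangle. Qed.

(** The uniform structure of [X] is kept, so completeness carries over unchanged; only radii are
    compared, and a positive radius in [R[i]] is real. *)
Lemma realified_entourage : entourage = entourage_ realified_ball.
Proof.
rewrite -[LHS](@entourage_ballE R[i] X); apply/seteqP; split=> A [e /= e0 eA].
  by have [r r0 er] := gt0_complex_real e0; rewrite er in eA; exists r.
by exists e%:C => //=; rewrite ltcR.
Qed.

HB.instance Definition _ := Uniform_isPseudoMetric.Build R XR
  realified_ball_center realified_ball_sym realified_ball_triangle
  realified_entourage.

Lemma realified_ball_norm : @ball R XR = ball_ (fun x => `|x|).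
Proof.
apply/funext => x; apply/funext => e; apply/seteqP; split=> y.
  by rewrite /ball /= /realified_ball -ball_normE /= realified_normE ltcR.
by rewrite /ball /= /realified_ball -ball_normE /= realified_normE ltcR.
Qed.

HB.instance Definition _ :=
  NormedZmod_PseudoMetric_eq.Build R XR realified_ball_norm.

Lemma realified_normrZ (a : R) (x : XR) : `|a *: x| = `|a| * `|x|.
Proof.
apply: (@complexI R); rewrite rmorphM /= -!realified_normE -normc_real.
exact: (@normrZ _ X).
Qed.

HB.instance Definition _ :=
  PseudoMetricNormedZmod_Lmodule_isNormedModule.Build R XR realified_normrZ.

End Realified.

HB.instance Definition _ (X : completeNormedModType R[i]) :=
  Uniform_isComplete.Build (realified X) (@cauchy_cvg X).

End ComplexScalars.

(** * Transfer of the real theorems to complex scalars *)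

Section ComplexTheorems.
Context {R : realType}.
Local Open Scope complex_scope.

Lemma complex_separating : @separating R[i].
Proof.
move=> V v v0.
have [f /bounded_operator_normP[fl [C C0 fC]] fv] :=
  @real_separating R (realified V) v v0.
pose f' := pack_linear fl; have fE x : f' x = f x by [].
have fD (x y : V) : f (x + y) = f x + f y by exact: (linearD f').
have fZ (a : R) (x : V) : f (a%:C *: x) = a * f x by exact: (linearZ_LR f').
have fN (x : V) : f (- x) = - f x by exact: (linearN f').
(* [g] is the complex functional with real part [f]. *)
pose g (x : V) : R[i]^o := f x +i* (- f ('i *: x)).
exists g; last by apply: contra fv; rewrite /g eq_complex => /andP[].
apply/bounded_operator_normP; split.
  move=> a x y; rewrite /g [a]complexE.
  set s := complex.Re a; set t := complex.Im a.
  have -> : 'i *: ((s%:C + 'i * t%:C) *: x + y) =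
      s%:C *: ('i *: x) - t%:C *: x + 'i *: y.
    rewrite scalerDr !scalerA mulrDr mulrA -expr2 sqr_i mulN1r scalerDl scaleNr.
    by rewrite mulrC.
  have -> : (s%:C + 'i * t%:C) *: x + y = s%:C *: x + t%:C *: ('i *: x) + y.
    by rewrite scalerDl scalerA [t%:C * _]mulrC.
  rewrite !fD !fN !fZ; apply/eqP; rewrite eq_complex /=.
  by apply/andP; split; apply/eqP; ring.
(* [|g x|] is at most [|f x| + |f ('i *: x)|], and ['i *: x] has the norm of [x]. *)
exists (C * 2)%:C; first by rewrite ltcR mulr_gt0.
move=> x; have iE : `|'i *: x| = `|x|.
  by rewrite normrZ (normc_def 'i) /= expr0n expr1n add0r sqrtr1 mul1r.
rewrite [g x]complexE; apply: le_trans (ler_normD _ _) _.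
rewrite normrM (normc_def 'i) /= expr0n expr1n add0r sqrtr1 mul1r.
rewrite !normc_real normrN realified_normE -!rmorphD -rmorphM lecR.
have := fC x; have := fC ('i *: x).
have -> : `|'i *: x : realified V| = `|x : realified V|.
  by apply: (@complexI R); rewrite -!realified_normE.
by rewrite -[`|x : realified V|]/(realified_norm x); lra.
Qed.

(** Restriction of scalars does not change [T] as a function, so the inverse found over the reals
    serves; it is complex linear because it inverts a complex linear map. *)
Lemma complex_bounded_inverse : @bounded_inverse_property R[i].
Proof.
move=> V W T bT TI Tsurj.
have [lT [c c0 Tc]] := (bounded_operator_normP T).1 bT.
have [C C0 cE] := gt0_complex_real c0.
have bTR : bounded_operator (T : realified V -> realified W).
  apply/bounded_operator_normP; split; first by move=> a x y; exact: lT.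
  exists C => // x; have := Tc x.
  by rewrite cE !realified_normE -rmorphM lecR.
have [T' [/bounded_operator_normP[_ [D D0 T'D]] TK T'K]] :=
  real_bounded_inverse bTR TI Tsurj.
exists T'; split=> //; apply/bounded_operator_normP; split.
  by move=> a x y; apply: TI; rewrite lT !T'K.
exists D%:C; first by rewrite ltcR.
by move=> w; rewrite !realified_normE -rmorphM lecR; exact: T'D.
Qed.

End ComplexTheorems.

Theorem theorem1p1 (R : realType) (s : scalars)
    (X Y : completeNormedModType (scalar_field R s))
    (U : X -> X) (V : Y -> Y)
    (bU : bounded_operator U) (bV : bounded_operator V)
    (iU : inessential U) (iV : inessential V) :
  ((EAE U V <-> EAOE U V) /\ (EAOE U V <-> Schur_coupled U V)) /\
  (EAE U V -> EAE_finite_dim U V /\ EAOE_finite_dim U V).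
Proof.
case: s X Y U V bU bV iU iV => X Y U V bU bV iU iV.
- apply: inessential_equivalences => //.
  + exact: real_separating.
  + exact: real_bounded_inverse.
  + exact: real_complete_field.
- apply: inessential_equivalences => //.
  + exact: complex_separating.
  + exact: complex_bounded_inverse.
  + exact: complex_complete_field.
Qed.
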